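(* (i) For every $L>0$, $\Delta\mapsto\mathrm P_\Delta(\hat\tau_{\rm ST}-\tau\le L(1+\gamma)^{-1/2}\sigma_0)$ is monotonically decreasing in $\Delta$. (ii) For every $t\in\mathbb R$ and $L$, with $c=c_{\alpha/2}$, \begin{align*} &\mathrm P_{\Delta/\sigma_0=t}\big(\hat\tau_{\rm ST}-\tau\le L(1+\gamma)^{-1/2}\sigma_0\big)\\ ={}&\Big[\Phi\big(c-\sqrt{\tfrac{\gamma}{1+\gamma}}t\big)-\Phi\big(-c-\sqrt{\tfrac{\gamma}{1+\gamma}}t\big)\Big]\Phi\big(L-\tfrac{\gamma}{\sqrt{1+\gamma}}t\big)\\ &+\int_{-\infty}^{-c-\sqrt{\frac{\gamma}{1+\gamma}}t}\Phi(L+\sqrt\gamma(u+c))\phi(u)\,du+\int_{c-\sqrt{\frac{\gamma}{1+\gamma}}t}^{\infty}\Phi(L+\sqrt\gamma(u-c))\phi(u)\,du. \end{align*} (iii) Let $\hat L'_{\rm ST}$ be the solution in $L$ of $\mathrm P_{\Delta/\sigma_0=b}\big(\hat\tau_{\rm ST}-\tau\le L(1+\gamma)^{-1/2}\sigma_0\big)=1-\zeta$. Then $[\hat\tau_{\rm ST}-\hat L'_{\rm ST}(1+\gamma)^{-1/2}\sigma_0,\infty)$ is the shortest lower confidence bound of this form with coverage at least $1-\zeta$ uniformly over $|\Delta/\sigma_0|\le b$.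
   Context: Let $\tau\in\mathbb R$ be an unknown parameter and $\Delta\in\mathbb R$ an unknown bias. Let $\sigma_0,\sigma_1>0$ be known. We observe independent random variables $\hat\tau_0\sim N(\tau,\sigma_0^2)$ and $\hat\tau_1\sim N(\tau+\Delta,\sigma_1^2)$. Define $\gamma=\sigma_0^2/\sigma_1^2$ and $\sigma=\sqrt{\sigma_0^2+\sigma_1^2}$. Write $\Phi$ and $\phi$ for the standard normal CDF and density. For $a\in(0,1)$, let $c_a=\Phi^{-1}(1-a)$. Fix $\alpha,\zeta\in(0,1)$ and $b\ge0$. The soft-thresholding estimator is \[ \hat\tau_{\rm ST}=\hat\tau_0+\frac{\gamma}{1+\gamma}(\hat\tau_1-\hat\tau_0)\mathbf 1(|\hat\tau_1-\hat\tau_0|\le\sigma c_{\alpha/2})+\frac{\gamma}{1+\gamma}\sigma c_{\alpha/2}\,\mathrm{sign}(\hat\tau_1-\hat\tau_0)\mathbf 1(|\hat\tau_1-\hat\tau_0|>\sigma c_{\alpha/2}). \] $\mathrm P_\Delta$ denotes probability under bias $\Delta$, and $\mathrm P_{\Delta/\sigma_0=t}$ means probability under $\Delta=t\sigma_0$. *)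

(* Defs.v *)
From HB Require Import structures.
From mathcomp Require Import all_boot all_order all_algebra.
From mathcomp Require Import all_classical all_reals all_analysis.
Set Implicit Arguments. Unset Strict Implicit. Unset Printing Implicit Defensive.
Import Order.TTheory GRing.Theory Num.Theory.
Local Open Scope classical_set_scope.
Local Open Scope ring_scope.

Section defs.
Context {R : realType}.

Definition Phi (x : R) : R := fine (normal_prob 0 1 `]-oo, x]).
Definition phi (x : R) : R := normal_pdf 0 1 x.

Definition gam (s0 s1 : R) : R := s0 ^+ 2 / s1 ^+ 2.
Definition sig (s0 s1 : R) : R := Num.sqrt (s0 ^+ 2 + s1 ^+ 2).

(* soft-thresholding estimator as a function of the observations (x0,x1) =
   (hat tau_0, hat tau_1), with threshold constant c = c_{alpha/2} *)
Definition tauST (s0 s1 c x0 x1 : R) : R :=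
  let g := gam s0 s1 in let s := sig s0 s1 in let d := x1 - x0 in
  if `|d| <= s * c then x0 + g / (1 + g) * d
  else x0 + g / (1 + g) * (s * c) * Num.sg d.

(* P_{tau,Delta}( hat tau_ST - tau <= L (1+gamma)^{-1/2} sigma0 ), where
   hat tau_0 ~ N(tau, s0^2) and hat tau_1 ~ N(tau+Delta, s1^2) are independent
   (joint law = product of the two normal laws). *)
Definition covprob (s0 s1 c tau Delta L : R) : \bar R :=
  ((normal_prob tau s0 \x normal_prob (tau + Delta) s1)
     [set p | (tauST s0 s1 c p.1 p.2 - tau
              <= L * (Num.sqrt (1 + gam s0 s1))^-1 * s0)%R])%E.

End defs.

(* Main.v *)
Require Import Defs.
From HB Require Import structures.
From mathcomp Require Import all_boot all_order all_algebra.
From mathcomp Require Import all_classical all_reals all_analysis.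
From mathcomp Require Import measurable_realfun ring lra.
Import Order.TTheory GRing.Theory Num.Theory.
Local Open Scope classical_set_scope.
Local Open Scope ring_scope.

(** The estimator is [x0 + w * clip(x1 - x0)] with [w = gamma / (1 + gamma)] and
    [clip] the truncation to [[- sigma c, sigma c]]. It is nondecreasing in [x1],
    so each section of the event in [x1] is a down-set, whose normal probability
    decreases with the mean; this is (i). For (ii), substitute [x1 = x0 + d]:
    completing the square, the joint density at [(x0, d)] is the density of
    [N(Delta, sigma^2)] at [d] times a normal density in [x0] whose mean is affine
    in [d]. Integrating [x0] out (Tonelli) and putting [d = Delta + sigma u] leaves
    [\int Phi(L + sqrt gamma (u - clip(u + a))) phi(u) du], and the integrand
    takes its three forms on the three pieces of the clipping. By (ii) the
    coverage does not depend on [tau] and is strictly increasing in [L]; with (i)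
    this gives (iii). *)

Section soft_thresholding.
Context {R : realType}.
Implicit Types (m s a b c x y : R).
Local Notation mu := (@lebesgue_measure R).

(** * Normal laws and their products through Lebesgue densities *)

Lemma normal_prob_indic m s (A : set R) :
  normal_prob m s A = (\int[mu]_x (\1_A x * normal_pdf m s x)%:E)%E.
Proof.
rewrite /normal_prob integral_mkcond; apply: eq_integral => x _.
by rewrite patchE indicE; case: ifP; rewrite ?mul1r ?mul0r.
Qed.

(** A normal law unfolds to its density only when it is evaluated on a set, so the two laws are
    treated one at a time. Fubini first makes [normal_prob m1 s1] the inner measure, applied to a
    [ysection]; once it is a Lebesgue integral, Tonelli swaps the order and the second law is
    evaluated on an [xsection]. *)
Lemma product_normal_probE m1 s1 m2 s2 (A : set (R * R)) : measurable A ->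
  ((normal_prob m1 s1 \x normal_prob m2 s2) A =
   \int[mu]_x \int[mu]_y (\1_A (x, y) * (normal_pdf m1 s1 x * normal_pdf m2 s2 y))%:E)%E.
Proof.
move=> mA.
have mf m s : measurable_fun [set: R] (normal_pdf m s) by exact: measurable_normal_pdf.
have mxA x : measurable (xsection A x) by exact: measurable_xsection.
have myA x : measurable (ysection A x) by exact: measurable_ysection.
transitivity (\int[normal_prob m2 s2]_y \int[mu]_x (\1_A (x, y) * normal_pdf m1 s1 x)%:E)%E.
  transitivity (\int[normal_prob m2 s2]_y normal_prob m1 s1 (ysection A y))%E.
    pose P1 : {sigma_finite_measure set _ -> \bar R} := normal_prob m1 s1.
    pose P2 : {sigma_finite_measure set _ -> \bar R} := normal_prob m2 s2.
    have F1 := @indic_fubini_tonelli_FE _ _ (measurableTypeR R) (measurableTypeR R) R P2 A mA.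
    have F2 := @indic_fubini_tonelli_GE _ _ (measurableTypeR R) (measurableTypeR R) R P1 A mA.
    have := @indic_fubini_tonelli _ _ (measurableTypeR R) (measurableTypeR R) R P1 P2 A mA.
    rewrite F1 F2; exact.
  apply: eq_integral => y _; rewrite normal_prob_indic; apply: eq_integral => x _.
  by rewrite !indicE mem_ysection.
rewrite -(@fubini_tonelli _ _ _ _ R mu (normal_prob m2 s2)
  (fun z => (\1_A z * normal_pdf m1 s1 z.1)%:E)); last 2 first.
- apply/measurable_EFinP/measurable_funM; first exact: measurable_indic.
  exact: (measurableT_comp (mf m1 s1) (@measurable_fst _ _ _ _)).
- by move=> z; rewrite lee_fin mulr_ge0// normal_pdf_ge0.
apply: eq_integral => x _ /=.
have -> : (\int[normal_prob m2 s2]_y (\1_A (x, y) * normal_pdf m1 s1 x)%:E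
    = (normal_pdf m1 s1 x)%:E * normal_prob m2 s2 (xsection A x))%E.
  under eq_integral => y _ do rewrite mulrC EFinM.
  rewrite ge0_integralZl ?lee_fin ?normal_pdf_ge0//; last first.
    by apply/measurable_EFinP/measurableT_comp => //; exact: pair1_measurable.
  congr (_ * _)%E; rewrite -[in RHS](setIT (xsection _ _)) -integral_indic; last exact: mxA.
    by apply: eq_integral => y _; rewrite !indicE mem_xsection.
  exact: measurableT.
rewrite normal_prob_indic -ge0_integralZl ?lee_fin ?normal_pdf_ge0//; last 2 first.
- apply/measurable_EFinP/measurable_funM; last exact: mf.
  by apply: measurable_indic; exact: mxA.
- by move=> y _; rewrite lee_fin mulr_ge0// normal_pdf_ge0.
apply: eq_integral => y _; rewrite -EFinM !indicE mem_xsection; congr EFin; ring.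
Qed.

(** * Affine changes of variable *)

(** The image of Lebesgue measure under [a * x + b], rescaled by [a], gives every interval []p, q]]
    its length. By uniqueness it is Lebesgue measure, and the formula is integration against a
    pushforward. *)
Lemma ge0_integral_affine a b (f : R -> \bar R) : 0 < a ->
  measurable_fun setT f -> (forall x, 0 <= f x)%E ->
  (\int[mu]_x f x = a%:E * \int[mu]_x f (a * x + b)%R)%E.
Proof.
move=> a0 mf f0.
pose g : measurableTypeR R -> measurableTypeR R := fun x => a * x + b.
have mg : measurable_fun setT g.
  by apply: measurable_funD => //; exact: measurable_funM.
(* [pushforward] is a measure only given a proof of measurability, so the instance
   is obtained by unification. *)
have [P PE] : exists P : {measure set (measurableTypeR R) -> \bar R},
    P = pushforward mu g :> (set _ -> \bar R).
  by unshelve (eexists; reflexivity).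
pose nu := mscale (NngNum (ltW a0)) P.
transitivity (\int[nu]_x f x)%E.
  apply: eq_measure_integral => A mA _.
  apply: (@lebesgue_measure_unique R nu) => // _ [[p q] _ <-].
  transitivity (a%:E * P `]p, q]%classic)%E => //=; rewrite PE /pushforward.
  have -> : g @^-1` `]p, q] = `](p - b) / a, (q - b) / a]%classic.
    apply/seteqP; split => x /=; rewrite !in_itv/= ltr_pdivrMr// ler_pdivlMr//;
    by rewrite ltrBlDr lerBrDr mulrC.
  rewrite !lebesgue_measure_itv/= !lte_fin ltr_pM2r ?invr_gt0// ltrD2r.
  case: ifP => _; last by rewrite mule0.
  rewrite -!EFinD -EFinM; congr EFin; field; lra.
rewrite ge0_integral_mscale//= PE ge0_integral_pushforward//.
Qed.

Lemma normal_peakE s : 0 < s -> normal_peak s = (s * Num.sqrt (pi *+ 2))^-1.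
Proof.
move=> s0; rewrite /normal_peak -mulrnAr sqrtrM ?sqr_ge0// sqrtr_sqr gtr0_norm//.
Qed.

Lemma normal_pdf_affine m s x : 0 < s -> s * normal_pdf m s (s * x + m) = phi x.
Proof.
move=> s0; rewrite /phi !normal_pdfE ?gt_eqF// !normal_peakE// mul1r.
rewrite invfM !mulrA divff ?gt_eqF// mul1r /normal_fun; congr (_ * expR _).
by field; rewrite gt_eqF.
Qed.

Lemma normal_prob_affine m s (A : set R) : 0 < s -> measurable A ->
  normal_prob m s A = normal_prob 0 1 [set x | A (s * x + m)].
Proof.
move=> s0 mA.
have mI : measurable_fun [set: R] (\1_A : R -> R) by exact: measurable_indic.
have mp : measurable_fun [set: R] (normal_pdf m s) by exact: measurable_normal_pdf.
rewrite !normal_prob_indic (ge0_integral_affine s m)//; last 2 first.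
- apply/measurable_EFinP/measurable_funM; first exact: measurable_indic.
  exact: measurable_normal_pdf.
- by move=> x; rewrite lee_fin mulr_ge0// normal_pdf_ge0.
have ms : measurable_fun [set: R] (fun x : R => s * x + m).
  by apply: measurable_funD => //; exact: measurable_funM.
rewrite -ge0_integralZl ?lee_fin ?(ltW s0)//; last 2 first.
- by apply/measurable_EFinP/measurable_funM; [exact: (measurableT_comp mI ms)
    |exact: (measurableT_comp mp ms)].
- by move=> x _; rewrite lee_fin mulr_ge0// normal_pdf_ge0.
apply: eq_integral => x _; rewrite -EFinM -[normal_pdf 0 1 x]/(phi x).
by rewrite -(normal_pdf_affine m s) // mulrCA !indicE.
Qed.

(** * The standard normal distribution function *)

Lemma PhiE x : (Phi x)%:E = normal_prob 0 1 `]-oo, x].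
Proof. by rewrite /Phi fineK// fin_num_measure. Qed.

Lemma normal_prob_itvNyc m s x : 0 < s ->
  normal_prob m s `]-oo, x] = (Phi ((x - m) / s))%:E.
Proof.
move=> s0; rewrite PhiE normal_prob_affine//; congr normal_prob.
by apply/seteqP; split => y /=; rewrite !in_itv/= ler_pdivlMr// lerBrDr mulrC.
Qed.

Lemma Phi_ge0 x : 0 <= Phi x.
Proof. by rewrite -lee_fin PhiE. Qed.

Lemma Phi_le1 x : Phi x <= 1.
Proof. by rewrite -lee_fin PhiE; apply: probability_le1. Qed.

Lemma normal_prob_itvoc x y : x <= y ->
  normal_prob 0 1 `]x, y] = (Phi y - Phi x)%:E.
Proof.
move=> xy; suff : ((Phi y)%:E = (Phi x)%:E + normal_prob 0 1 `]x, y])%E.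
  by rewrite EFinB => ->; rewrite addeAC subee ?add0e.
rewrite !PhiE; have -> : `]-oo, y]%classic = `]-oo, x] `|` `]x, y]%classic :> set R.
  by rewrite -itv_bndbnd_setU// bnd_simp.
apply: measureU => //.
by apply/seteqP; split => z //= []; rewrite !in_itv/=; lra.
Qed.

(** If []x, y]] had mass zero, the density would vanish almost everywhere on it. The density is
    positive everywhere, so []x, y]] would lie in a null set, against its positive length. *)
Lemma Phi_lt x y : x < y -> Phi x < Phi y.
Proof.
move=> xy; rewrite -subr_gt0 -lte_fin -normal_prob_itvoc ?(ltW xy)//.
rewrite lt_neqAle measure_ge0 andbT eq_sym; apply/eqP => P0.
have mf : measurable_fun `]x, y] (EFin \o (@normal_pdf R 0 1)).
  by apply/measurable_EFinP/measurable_funTS; exact: measurable_normal_pdf.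
have I0 : (\int[mu]_(z in `]x, y]) `|(EFin \o normal_pdf 0 1) z| = 0)%E.
  rewrite -[RHS]P0; apply: eq_integral => z _ /=.
  by rewrite ger0_norm// normal_pdf_ge0.
have mxy : measurable (`]x, y]%classic : set R) by [].
have [N [mN N0 H]] := (ae_eq_integral_abs mu mxy mf).1 I0.
have : (mu `]x, y] <= mu N)%E.
  apply: le_measure; rewrite ?inE// => z zxy; apply: H => /(_ zxy)/= [].
  rewrite normal_pdfE ?oner_eq0//; apply/eqP; rewrite gt_eqF// mulr_gt0 ?expR_gt0//.
  by rewrite normal_peak_gt0 ?oner_eq0.
by rewrite N0 lebesgue_measure_itv/= lte_fin xy -EFinD lee_fin; lra.
Qed.

Lemma Phi_le : {homo @Phi R : x y / x <= y}.
Proof. by move=> x y; rewrite le_eqVlt => /predU1P[->//|/Phi_lt/ltW]. Qed.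

Lemma measurable_Phi : measurable_fun [set: R] Phi.
Proof. by apply: nondecreasing_measurable => // x y; exact: Phi_le. Qed.

(** The density is even, so the reflection at 0 shows that the two half-lines have equal mass. This
    value is what locates [c] on the positive side in the theorem. *)
Lemma Phi0 : Phi 0 = 1 / 2 :> R.
Proof.
have mf D : measurable_fun D (fun x : R => (normal_pdf 0 1 x)%:E).
  by apply/measurable_EFinP/measurable_funTS; exact: measurable_normal_pdf.
suff : ((Phi 0 : R)%:E + (Phi 0 : R)%:E = 1)%E by rewrite -EFinD => -[]; lra.
rewrite -(@probability_setT _ _ _ (normal_prob 0 1 : probability _ R)).
have -> : [set: R] = `]-oo, 0%R] `|` `]0%R, +oo[.
  apply/seteqP; split => z //= _; rewrite !in_itv/= andbT.
  by case: (leP z 0); [left|right].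
rewrite measureU//; last first.
  by apply/seteqP; split => z //= []; rewrite !in_itv/=; lra.
rewrite PhiE; congr (_ + _)%E; rewrite /= /normal_prob [RHS]integral_itv_obnd_cbnd//.
rewrite ge0_integration_by_substitution0//.
  apply: eq_integral => x _; rewrite !normal_pdfE ?oner_eq0//; congr (_ * expR _)%:E.
  by rewrite !subr0 sqrrN.
by move=> x; rewrite lee_fin normal_pdf_ge0.
Qed.

(** * Law of an observation plus a function of the difference *)

(** The right-hand side is the marginal density of the difference [d] times the conditional density
    of the first observation given [d]. The covariance of the first observation with [d] is
    [- s0 ^+ 2], which gives the regression slope; the residual variance is
    [s0 ^+ 2 - s0 ^+ 4 / s ^+ 2], the square of [s0 * s1 / s]. *)
Lemma normal_pdf_mul m0 m1 s0 s1 x d : 0 < s0 -> 0 < s1 ->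
  let s := Num.sqrt (s0 ^+ 2 + s1 ^+ 2) in
  normal_pdf m0 s0 x * normal_pdf m1 s1 (x + d) =
  normal_pdf (m1 - m0) s d *
  normal_pdf (m0 - s0 ^+ 2 / s ^+ 2 * (d - (m1 - m0))) (s0 * s1 / s) x.
Proof.
move=> s00 s10 s.
have s2 : s ^+ 2 = s0 ^+ 2 + s1 ^+ 2 by rewrite sqr_sqrtr// addr_ge0 ?sqr_ge0.
have s_gt0 : 0 < s by rewrite sqrtr_gt0 ltr_wpDr ?sqr_ge0 ?exprn_gt0.
clearbody s; have v0 : 0 < s0 * s1 / s by rewrite divr_gt0 ?mulr_gt0.
rewrite !normal_pdfE ?gt_eqF// !normal_peakE// /normal_fun mulrACA [RHS]mulrACA.
rewrite -!expRD; congr (_ * expR _).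
  have : Num.sqrt (pi *+ 2) != 0 :> R by rewrite gt_eqF// sqrtr_gt0 pmulrn_lgt0 ?pi_gt0.
  by move: (Num.sqrt _) => k k0; field; rewrite k0 !gt_eqF.
rewrite exprMn exprVn exprMn s2; field; rewrite !gt_eqF ?exprn_gt0//=.
by rewrite ltr_wpDr ?sqr_ge0 ?exprn_gt0.
Qed.

Lemma measurable_shrunk_le (h : R -> R) (K : R) : measurable_fun setT h ->
  measurable [set p : R * R | p.1 + h (p.2 - p.1) <= K].
Proof.
move=> mh; have mg : measurable_fun [set: R * R] (fun p : R * R => p.1 + h (p.2 - p.1)).
  by apply: measurable_funD => //; apply: measurableT_comp => //; exact: measurable_funB.
rewrite -[X in measurable X]setTI.
have -> : [set p : R * R | p.1 + h (p.2 - p.1) <= K] =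
  (fun p : R * R => p.1 + h (p.2 - p.1)) @^-1` `]-oo, K].
  by apply/seteqP; split => p /=; rewrite in_itv.
exact: mg.
Qed.

(** Given the difference [d], the event is the half-line below [K - h d] in the first observation,
    so its conditional probability is a value of [Phi]. It remains to average over the law of [d],
    written in the standardized variable [u]. *)
Lemma product_normal_prob_shrunk m0 m1 s0 s1 (K : R) (h : R -> R) :
  0 < s0 -> 0 < s1 -> measurable_fun setT h ->
  let s := Num.sqrt (s0 ^+ 2 + s1 ^+ 2) in
  ((normal_prob m0 s0 \x normal_prob m1 s1)
     [set p : R * R | (p.1 + h (p.2 - p.1) <= K)%R] =
   \int[mu]_u (Phi ((K - h (s * u + (m1 - m0)) - m0 + s0 ^+ 2 / s * u)
                      / (s0 * s1 / s)) * phi u)%:E)%E.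
Proof.
move=> s00 s10 mh s.
have s_gt0 : 0 < s by rewrite sqrtr_gt0 ltr_wpDr ?sqr_ge0 ?exprn_gt0.
have v0 : 0 < s0 * s1 / s by rewrite divr_gt0 ?mulr_gt0.
have mA := measurable_shrunk_le _ K mh.
rewrite product_normal_probE//; set A := [set p | _].
have mI : measurable_fun [set: R * R] (\1_A : R * R -> R) by exact: measurable_indic.
have mp m t : measurable_fun [set: R] (normal_pdf m t) by exact: measurable_normal_pdf.
have mI1 x : measurable_fun [set: R] (fun y => \1_A (x, y) : R).
  by apply: (measurableT_comp mI); exact: pair1_measurable.
have mshear : measurable_fun [set: R * R] (fun z : R * R => (z.1, z.1 + z.2)).
  by apply: measurable_fun_pair => //; exact: measurable_funD.
(* [m d] is the conditional mean of the first observation given the difference [d]. *)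
pose m d := m0 - s0 ^+ 2 / s ^+ 2 * (d - (m1 - m0)).
(* For fixed [x], the passage from [y] to [d = y - x] is a translation. *)
transitivity (\int[mu]_x \int[mu]_d
  (\1_A (x, x + d) * (normal_pdf m0 s0 x * normal_pdf m1 s1 (x + d)))%:E)%E.
  apply: eq_integral => x _; rewrite (ge0_integral_affine 1 x)//.
  - by rewrite mul1e; apply: eq_integral => d _; rewrite mul1r addrC.
  - by apply/measurable_EFinP/measurable_funM => //; exact: measurable_funM.
  - by move=> y; rewrite lee_fin !mulr_ge0// normal_pdf_ge0.
rewrite (@fubini_tonelli _ _ _ _ R mu mu (fun z : R * R =>
  (\1_A (z.1, z.1 + z.2) * (normal_pdf m0 s0 z.1 * normal_pdf m1 s1 (z.1 + z.2)))%:E));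
  last 2 first.
- apply/measurable_EFinP/measurable_funM; first exact: (measurableT_comp mI mshear).
  apply: measurable_funM; first exact: (measurableT_comp (mp _ _)).
  by apply: (measurableT_comp (mp _ _)); exact: measurable_funD.
- by move=> z; rewrite lee_fin !mulr_ge0// normal_pdf_ge0.
(* After the swap of integrals, [normal_pdf_mul] frees the marginal density of [d] from the inner
   integral; what is left there is the conditional law of a half-line. *)
transitivity (\int[mu]_d
    (normal_pdf (m1 - m0) s d * Phi ((K - h d - m d) / (s0 * s1 / s)))%:E)%E.
  apply: eq_integral => d _ /=.
  have -> : (normal_pdf (m1 - m0) s d * Phi ((K - h d - m d) / (s0 * s1 / s)))%:E =
      ((normal_pdf (m1 - m0) s d)%:E *
       normal_prob (m d) (s0 * s1 / s) `]-oo, (K - h d)%R])%E.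
    by rewrite normal_prob_itvNyc.
  rewrite normal_prob_indic.
  pose f x := (\1_`]-oo, (K - h d)%R] x * normal_pdf (m d) (s0 * s1 / s) x)%:E.
  have mf : measurable_fun setT f.
    apply/measurable_EFinP/measurable_funM; last exact: (mp (m d) (s0 * s1 / s)).
    have mItv : measurable_fun [set: R] (\1_`]-oo, (K - h d)%R] : R -> R).
      exact: measurable_indic.
    exact: mItv.
  have f0 x : setT x -> (0 <= f x)%E.
    by move=> _; rewrite lee_fin mulr_ge0// normal_pdf_ge0.
  rewrite -[X in (_ * X)%E]/(\int[mu]_x f x)%E.
  rewrite -(ge0_integralZl mu measurableT mf f0); last by rewrite lee_fin normal_pdf_ge0.
  apply: eq_integral => x _; rewrite -EFinM normal_pdf_mul// mulrCA.
  rewrite (_ : \1_A _ = \1_`]-oo, (K - h d)%R] x)// !indicE.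
  congr (nat_of_bool _)%:R; apply/idP/idP; rewrite !inE /A/= in_itv/= (addrC x d) addrK;
  by rewrite lerBrDr.
pose k d := normal_pdf (m1 - m0) s d * Phi ((K - h d - m d) / (s0 * s1 / s)).
have mk : measurable_fun [set: R] k.
  apply: measurable_funM => //; apply: (measurableT_comp measurable_Phi).
  apply: measurable_funM => //; apply: measurable_funB; first exact: measurable_funB.
  by apply: measurable_funB => //; apply: measurable_funM => //; exact: measurable_funB.
have k0 d : 0 <= k d by rewrite mulr_ge0 ?normal_pdf_ge0 ?Phi_ge0.
(* Standardization of [d]; the Jacobian [s] turns its density into [phi]. *)
rewrite (ge0_integral_affine s (m1 - m0) (EFin \o k))//; last first.
  exact/measurable_EFinP.
pose g u := (k (s * u + (m1 - m0)))%:E.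
have mg : measurable_fun [set: R] g.
  apply/measurable_EFinP/(measurableT_comp mk).
  by apply: measurable_funD => //; exact: measurable_funM.
have g0 u : setT u -> (0 <= g u)%E by rewrite lee_fin.
rewrite -[X in (_ * X)%E]/(\int[mu]_u g u)%E.
rewrite -(ge0_integralZl mu measurableT mg g0); last by rewrite lee_fin ltW.
apply: eq_integral => u _; rewrite /g /k -EFinM mulrA normal_pdf_affine//.
rewrite mulrC /m addrK.
have -> : s0 ^+ 2 / s * u = s0 ^+ 2 / s ^+ 2 * (s * u).
  clearbody s; field; exact: lt0r_neq0.
by rewrite opprB addrA addrAC.
Qed.

(** * Monotonicity of normal laws in the mean *)

(** Under one standard normal variable [x], the event becomes [A (s * x + m)]; for a down-set this
    shrinks as [m] grows. *)
Lemma normal_prob_downset m1 m2 s (A : set R) : 0 < s -> measurable A ->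
  (forall x y, x <= y -> A y -> A x) -> m1 <= m2 ->
  (normal_prob m2 s A <= normal_prob m1 s A)%E.
Proof.
move=> s0 mA dA m12; rewrite normal_prob_affine// [leRHS]normal_prob_affine//.
have mf m : measurable [set x | A (s * x + m)].
  rewrite -[X in measurable X]setTI.
  have : measurable_fun [set: R] (fun x : R => s * x + m).
    by apply: measurable_funD => //; exact: measurable_funM.
  exact.
apply: le_measure; [by apply/mem_set; exact: mf|by apply/mem_set; exact: mf|].
by move=> x /=; apply: dA; rewrite lerD2l.
Qed.

(** * Clipping and the soft-thresholding estimator *)

Definition clip c x : R := Num.max (- c) (Num.min c x).

Lemma clip_le c : {homo clip c : x y / x <= y}.
Proof.
move=> x y xy; rewrite /clip.
case: (leP c x) => ?; case: (leP c y) => ?; rewrite /Num.max;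
by do !case: ifPn; rewrite -?leNgt; lra.
Qed.

Lemma measurable_clip c : measurable_fun setT (clip c).
Proof. by apply: nondecreasing_measurable => // x y; exact: clip_le. Qed.

Lemma clip_id c x : - c <= x <= c -> clip c x = x.
Proof. by move=> /andP[? ?]; rewrite /clip min_r// max_r. Qed.

Lemma clip_l c x : 0 <= c -> x <= - c -> clip c x = - c.
Proof. by move=> ? ?; rewrite /clip min_r ?max_l//; lra. Qed.

Lemma clip_r c x : 0 <= c -> c <= x -> clip c x = c.
Proof. by move=> ? ?; rewrite /clip min_l ?max_r//; lra. Qed.

Lemma clipZ k c x : 0 < k -> clip (k * c) (k * x) = k * clip c x.
Proof. by move=> k0; rewrite /clip maxr_pMr ?minr_pMr ?mulrN// ltW. Qed.

Lemma tauSTE s0 s1 c x0 x1 : 0 <= c ->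
  tauST s0 s1 c x0 x1 =
  x0 + gam s0 s1 / (1 + gam s0 s1) * clip (sig s0 s1 * c) (x1 - x0).
Proof.
move=> c0; rewrite /tauST; set k := sig _ _ * c.
have k0 : 0 <= k by rewrite mulr_ge0// sqrtr_ge0.
rewrite ler_norml; case: ifPn => [H|]; first by rewrite clip_id.
(* Beyond the threshold the difference is nonzero because [k] is nonnegative, so its sign is 1 or -1
   and selects the end of the clipping interval. *)
rewrite negb_and -!ltNge -mulrA => /orP[] H.
  by rewrite clip_l ?(ltW H)// ltr0_sg ?mulrN1//; lra.
by rewrite clip_r ?(ltW H)// gtr0_sg ?mulr1//; lra.
Qed.

(** * Coverage as a function of the bias *)

Lemma covprob_clip s0 s1 c tau D L : 0 <= c ->
  covprob s0 s1 c tau D L =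
  ((normal_prob tau s0 \x normal_prob (tau + D) s1)
    [set p : R * R | (p.1 + gam s0 s1 / (1 + gam s0 s1) * clip (sig s0 s1 * c) (p.2 - p.1)
      <= tau + L * (Num.sqrt (1 + gam s0 s1))^-1 * s0)%R])%E.
Proof.
move=> c0; rewrite /covprob; congr (_ _); apply/seteqP.
by split => p /=; rewrite tauSTE// lerBlDl.
Qed.

Lemma gam_gt0 s0 s1 : 0 < s0 -> 0 < s1 -> 0 < gam s0 s1.
Proof. by move=> ? ?; rewrite divr_gt0 ?exprn_gt0. Qed.

Lemma covprob_le s0 s1 c tau D1 D2 L : 0 < s0 -> 0 < s1 -> 0 <= c -> D1 <= D2 ->
  (covprob s0 s1 c tau D2 L <= covprob s0 s1 c tau D1 L)%E.
Proof.
move=> s00 s10 c0 D12; rewrite (covprob_clip _ _ _ _ D2 _ c0) (covprob_clip _ _ _ _ D1 _ c0).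
set w := gam _ _ / _; set K := tau + L * _ * _.
have w0 : 0 <= w by rewrite divr_ge0 ?addr_ge0// ltW// gam_gt0.
pose h x := w * clip (sig s0 s1 * c) x.
have mh : measurable_fun [set: R] h.
  by apply: measurable_funM => //; exact: measurable_clip.
have mA := measurable_shrunk_le h K mh.
set A := [set p : R * R | _].
have mP D : measurable_fun [set: R] (normal_prob (tau + D) s1 \o xsection A).
  exact: (@measurable_fun_xsection _ _ (measurableTypeR R) (measurableTypeR R) R
    (normal_prob (tau + D) s1) A mA).
(* The product measure is by definition the integral, over the first law, of the second law of the
   sections; it is enough to compare the sections. *)
apply: ge0_le_integral.
- exact: measurableT.
- by move=> x _; exact: measure_ge0.
- exact: mP.
- exact: mP.
- move=> x _ /=; apply: normal_prob_downset => //; last by rewrite lerD2l.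
    exact: measurable_xsection.
  move=> y z yz; rewrite !xsectionE/=; apply: le_trans.
  by rewrite lerD2l ler_wpM2l// clip_le// lerD2r.
Qed.

(** Here [a] is the bias [t * s0] divided by [sig s0 s1], so the standardized difference is [u + a].
    The factor multiplying [L] in the event is exactly the conditional standard deviation of the
    first observation given the difference. In this unit the regression term and the clipped term
    both get the coefficient [Num.sqrt g], and [tau] cancels. *)
Lemma covprob_integral s0 s1 c tau t L : 0 < s0 -> 0 < s1 -> 0 <= c ->
  let g := gam s0 s1 in
  let a := Num.sqrt (g / (1 + g)) * t in
  (covprob s0 s1 c tau (t * s0) L =
   \int[mu]_u (Phi (L + Num.sqrt g * (u - clip c (u + a))) * phi u)%:E)%E.
Proof.
move=> s00 s10 c0 g a.
have g0 : 0 < g by exact: gam_gt0.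
have q0 : 0 < Num.sqrt (1 + g) by rewrite sqrtr_gt0 addr_gt0.
have rE : Num.sqrt g = s0 / s1.
  by rewrite /g /gam -expr_div_n sqrtr_sqr gtr0_norm// divr_gt0.
have sE : sig s0 s1 = s1 * Num.sqrt (1 + g).
  rewrite /sig -[in RHS](gtr0_norm s10) -sqrtr_sqr -sqrtrM ?sqr_ge0//.
  by rewrite mulrDr mulr1 /g /gam mulrC divfK ?gt_eqF ?exprn_gt0// addrC.
have aE : a = s0 / s1 / Num.sqrt (1 + g) * t.
  by rewrite /a sqrtrM ?ltW// sqrtrV ?rE// ltW// addr_gt0.
have gE : g = (s0 / s1) ^+ 2 by rewrite expr_div_n.
rewrite covprob_clip// -/g.
pose h x := g / (1 + g) * clip (sig s0 s1 * c) x.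
have mh : measurable_fun [set: R] h.
  by apply: measurable_funM => //; exact: measurable_clip.
have /= -> := product_normal_prob_shrunk tau (tau + t * s0) _ _
  (tau + L * (Num.sqrt (1 + g))^-1 * s0) _ s00 s10 mh.
apply: eq_integral => u _; congr (Phi _ * _)%:E.
rewrite -/(sig s0 s1) sE rE /h sE.
have -> : s1 * Num.sqrt (1 + g) * u + (tau + t * s0 - tau)
    = s1 * Num.sqrt (1 + g) * (u + a).
  by rewrite aE; move: q0; set q := Num.sqrt _ => q0; field; rewrite !gt_eqF.
rewrite clipZ ?mulr_gt0//.
(* With [1 + g] written as the square of [q], the claim is an identity of rational functions. *)
have : 1 + g = Num.sqrt (1 + g) ^+ 2 by rewrite sqr_sqrtr// ltW// addr_gt0.
move: (Num.sqrt (1 + g)) (clip c (u + a)) q0 => q y q0 ->; rewrite gE; field.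
by rewrite !gt_eqF.
Qed.

(** * The three-piece formula *)

Lemma measurable_Phi_shift r b (f : R -> R) : measurable_fun setT f ->
  measurable_fun setT (fun u => (Phi (b + r * f u) * phi u)%:E).
Proof.
move=> mf; apply/measurable_EFinP/measurable_funM; last exact: measurable_normal_pdf.
apply: (measurableT_comp measurable_Phi); apply: measurable_funD => //.
exact: measurable_funM.
Qed.

Lemma Phi_phi_ge0 x y : (0 <= (Phi x * phi y)%:E)%E.
Proof. by rewrite lee_fin mulr_ge0 ?Phi_ge0 ?normal_pdf_ge0. Qed.

(** The last two pieces share the null point [y]; closing the last one at [y] matches the form of
    the formula in (ii). *)
Lemma ge0_integral_split3 x y (F : R -> \bar R) : x <= y ->
  measurable_fun setT F -> (forall u, 0 <= F u)%E ->
  (\int[mu]_u F u = \int[mu]_(u in `]-oo, x]) F u + \int[mu]_(u in `]x, y]) F u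
    + \int[mu]_(u in `[y, +oo[) F u)%E.
Proof.
move=> xy mF F0.
have mFD (D : set R) : measurable_fun D F by exact: measurable_funTS.
rewrite -integral_itv_obnd_cbnd; last exact: mFD.
have -> : [set: R] = `]-oo, y] `|` `]y, +oo[.
  by apply/seteqP; split => u //= _; rewrite !in_itv/= andbT; case: (leP u y); [left|right].
rewrite ge0_integral_setU//; last 2 first.
- exact: mFD.
- by apply/disj_setPS => u/= []; rewrite !in_itv/= andbT; lra.
have -> : `]-oo, y]%classic = `]-oo, x] `|` `]x, y] :> set R.
  by rewrite -itv_bndbnd_setU// bnd_simp.
rewrite ge0_integral_setU//; first exact: mFD.
by apply/disj_setPS => u/= []; rewrite !in_itv/=; lra.
Qed.

Lemma covprob_split s0 s1 c tau t L : 0 < s0 -> 0 < s1 -> 0 < c ->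
  let g := gam s0 s1 in
  let a := Num.sqrt (g / (1 + g)) * t in
  covprob s0 s1 c tau (t * s0) L =
  (((Phi (c - a) - Phi (- c - a)) * Phi (L - g / Num.sqrt (1 + g) * t))%:E
   + (\int[mu]_(u in `]-oo, (- c - a)%R])
        (Phi (L + Num.sqrt g * (u + c)) * phi u)%:E)
   + (\int[mu]_(u in `[(c - a)%R, +oo[)
        (Phi (L + Num.sqrt g * (u - c)) * phi u)%:E))%E.
Proof.
move=> s00 s10 c0 g a; rewrite covprob_integral ?(ltW c0)// -/g -/a.
set F := fun u => _.
have mF : measurable_fun setT F.
  apply: measurable_Phi_shift; apply: measurable_funB => //.
  apply: (measurableT_comp (measurable_clip _)); exact: measurable_funD.
have F0 u : (0 <= F u)%E by exact: Phi_phi_ge0.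
have -> : g / Num.sqrt (1 + g) * t = Num.sqrt g * a.
  rewrite /a; move: (g) (gam_gt0 _ _ s00 s10 : 0 < g) => k k0.
  rewrite sqrtrM ?ltW// sqrtrV ?ltW ?addr_gt0// 2!mulrA -expr2.
  by rewrite sqr_sqrtr ?ltW.
have Fl : (\int[mu]_(u in `]-oo, (- c - a)%R]) F u =
    \int[mu]_(u in `]-oo, (- c - a)%R]) (Phi (L + Num.sqrt g * (u + c)) * phi u)%:E)%E.
  apply: eq_integral => u; rewrite inE/= in_itv/= => u1.
  have ul : u + a <= - c by lra.
  by rewrite /F (clip_l _ _ (ltW c0) ul) opprK.
have Fr : (\int[mu]_(u in `[(c - a)%R, +oo[) F u =
    \int[mu]_(u in `[(c - a)%R, +oo[) (Phi (L + Num.sqrt g * (u - c)) * phi u)%:E)%E.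
  apply: eq_integral => u; rewrite inE/= in_itv/= andbT => u1.
  have ur : c <= u + a by lra.
  by rewrite /F (clip_r _ _ (ltW c0) ur).
(* Between the thresholds clipping is the identity and [u] cancels in the argument of [Phi]. That
   factor is then constant, and the remaining integral is the normal mass of the piece. *)
have Fm : (\int[mu]_(u in `](- c - a)%R, (c - a)%R]) F u =
    ((Phi (c - a) - Phi (- c - a)) * Phi (L - Num.sqrt g * a))%:E)%E.
  transitivity (\int[mu]_(u in `](- c - a)%R, (c - a)%R])
      ((Phi (L - Num.sqrt g * a))%:E * (normal_pdf 0 1 u)%:E))%E.
    apply: eq_integral => u; rewrite inE/= in_itv/= => /andP[u1 u2].
    rewrite /F -EFinM clip_id; last by apply/andP; split; lra.
    by congr (Phi _ * _)%:E; ring.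
  pose f (u : R) := (normal_pdf 0 1 u)%:E.
  have mf : measurable_fun `](- c - a), (c - a)] f.
    by apply/measurable_EFinP/measurable_funTS; exact: measurable_normal_pdf.
  have f0 u : `](- c - a), (c - a)]%classic u -> (0 <= f u)%E.
    by rewrite lee_fin normal_pdf_ge0.
  rewrite (ge0_integralZl mu (measurable_itv _) mf f0); last by rewrite lee_fin Phi_ge0.
  have acc : - c - a <= c - a by lra.
  have -> : (\int[mu]_(u in `](- c - a)%R, (c - a)%R]) f u = (Phi (c - a) - Phi (- c - a))%:E)%E.
    exact: normal_prob_itvoc.
  by rewrite -EFinM (mulrC (Phi (L - _))).
rewrite (ge0_integral_split3 (- c - a) (c - a) F _ mF F0); last by lra.
by rewrite Fl Fr Fm (addeC (\int[mu]_(u in `]-oo, _]) _)%E).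
Qed.

(** * Strict monotonicity in [L] *)

(** Since [Phi] is at most 1, the integral is at most the normal mass of [D]. Finiteness is what
    allows a strict inequality to survive addition in [\bar R]. *)
Lemma Phi_phi_integral_fin_num (D : set R) r b (f : R -> R) :
  measurable D -> measurable_fun setT f ->
  (\int[mu]_(u in D) (Phi (b + r * f u) * phi u)%:E)%E \is a fin_num.
Proof.
move=> mD mf; apply/fin_numPlt/andP; split.
  by apply: (@lt_le_trans _ _ 0%E) => //; apply: integral_ge0 => u _; exact: Phi_phi_ge0.
apply: (@le_lt_trans _ _ (normal_prob 0 1 D)); last first.
  by apply: (@le_lt_trans _ _ 1%E); [exact: probability_le1|exact: ltry].
apply: ge0_le_integral => //.
- by move=> u _; exact: Phi_phi_ge0.
- by apply: measurable_funTS; exact: measurable_Phi_shift.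
- by apply/measurable_EFinP/measurable_funTS; exact: measurable_normal_pdf.
- by move=> u _; rewrite lee_fin ler_piMl ?normal_pdf_ge0 ?Phi_le1.
Qed.

Lemma le_Phi_phi_integral (D : set R) r b b' (f : R -> R) :
  measurable D -> measurable_fun setT f -> b <= b' ->
  (\int[mu]_(u in D) (Phi (b + r * f u) * phi u)%:E <=
   \int[mu]_(u in D) (Phi (b' + r * f u) * phi u)%:E)%E.
Proof.
move=> mD mf bb'; apply: ge0_le_integral => //.
- by move=> u _; exact: Phi_phi_ge0.
- by apply: measurable_funTS; exact: measurable_Phi_shift.
- by apply: measurable_funTS; exact: measurable_Phi_shift.
- by move=> u _; rewrite lee_fin ler_wpM2r ?normal_pdf_ge0// Phi_le// lerD2r.
Qed.

(** Strictness comes from the middle term of the split: its weight is positive because [c] is, and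
    [Phi] is strictly increasing. The two tail integrals only need to be finite and nondecreasing in
    [L]. *)
Lemma covprob_lt s0 s1 c tau t L L' : 0 < s0 -> 0 < s1 -> 0 < c -> L < L' ->
  (covprob s0 s1 c tau (t * s0) L < covprob s0 s1 c tau (t * s0) L')%E.
Proof.
move=> s00 s10 c0 LL'.
rewrite (covprob_split _ _ _ tau t L s00 s10 c0) (covprob_split _ _ _ tau t L' s00 s10 c0).
have m1 : measurable_fun [set: R] (fun u : R => u + c) by exact: measurable_funD.
have m2 : measurable_fun [set: R] (fun u : R => u - c) by exact: measurable_funB.
apply: lte_leD; [|apply: lte_leD|].
- exact: Phi_phi_integral_fin_num.
- exact: Phi_phi_integral_fin_num.
- rewrite lte_fin ltr_pM2l; first by rewrite Phi_lt// ltrD2r.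
  by rewrite subr_gt0 Phi_lt//; lra.
- by apply: le_Phi_phi_integral => //; exact: ltW.
- by apply: le_Phi_phi_integral => //; exact: ltW.
Qed.

End soft_thresholding.

Theorem theorem15 (R : realType) (s0 s1 alpha zeta b c : R) :
  0 < s0 -> 0 < s1 -> 0 < alpha < 1 -> 0 < zeta < 1 -> 0 <= b ->
  Phi c = 1 - alpha / 2 ->
  (* (i) *)
  (forall L tau D1 D2 : R, 0 < L -> D1 <= D2 ->
     (covprob s0 s1 c tau D2 L <= covprob s0 s1 c tau D1 L)%E) /\
  (* (ii) *)
  (forall t L tau : R,
     let g := gam s0 s1 in
     let a := Num.sqrt (g / (1 + g)) * t in
     covprob s0 s1 c tau (t * s0) L =
     (((Phi (c - a) - Phi (- c - a)) * Phi (L - g / Num.sqrt (1 + g) * t))%:E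
      + (\int[lebesgue_measure]_(u in `]-oo, (- c - a)%R])
           (Phi (L + Num.sqrt g * (u + c)) * phi u)%:E)
      + (\int[lebesgue_measure]_(u in `[(c - a)%R, +oo[)
           (Phi (L + Num.sqrt g * (u - c)) * phi u)%:E))%E) /\
  (* (iii) *)
  (forall tau0 Lhat : R,
     covprob s0 s1 c tau0 (b * s0) Lhat = (1 - zeta)%:E ->
     (forall tau D : R, `|D| <= b * s0 ->
        ((1 - zeta)%:E <= covprob s0 s1 c tau D Lhat)%E) /\
     (forall L : R,
        (forall tau D : R, `|D| <= b * s0 ->
           ((1 - zeta)%:E <= covprob s0 s1 c tau D L)%E) ->
        Lhat <= L)).
Proof.
move=> s00 s10 alpha01 _ b0 Phic.
(* Otherwise [Phi c] would be at most [Phi 0], that is 1/2, whereas [1 - alpha / 2] exceeds 1/2. *)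
have c0 : 0 < c by rewrite ltNge; apply/negP => /Phi_le; rewrite Phic Phi0; lra.
split; first by move=> L tau D1 D2 _; apply: covprob_le => //; exact: ltW.
split; first by move=> t L tau; exact: covprob_split.
move=> tau0 Lhat LhatE; split.
  move=> tau D /ler_normlP[_ Db].
  (* By (i) the least favorable bias is [b * s0]. The equation for [Lhat] is given at [tau0] and is
     carried to [tau] by (ii), whose right-hand side is free of [tau]. *)
  apply: (@le_trans _ _ (covprob s0 s1 c tau (b * s0) Lhat)).
    rewrite -LhatE (covprob_split _ _ _ tau0 b Lhat s00 s10 c0).
    by rewrite (covprob_split _ _ _ tau b Lhat s00 s10 c0).
  by apply: covprob_le => //; exact: ltW.
(* An [L] below [Lhat] would have coverage strictly under [1 - zeta] at the admissible bias
   [b * s0]. *)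
move=> L covL; rewrite leNgt; apply/negP => /(covprob_lt _ _ _ tau0 b _ _ s00 s10 c0).
rewrite LhatE ltNge => /negP; apply; apply: covL.
by rewrite ger0_norm// mulr_ge0// ltW.
Qed.
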